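(* Let $(X,\phi)$ be a non-compact, connected calibrated manifold. The following two conditions are equivalent. 1) If $K\subset\subset X$, then $\widehat K\subset\subset X$. 2) There exists a $\phi$-plurisubharmonic proper exhaustion function $f$ on $X$.
   Context: A calibrated manifold $(X,\phi)$ of degree $p\ge 1$ is a smooth riemannian manifold $X$ together with a closed smooth $p$-form $\phi$ such that $\phi(\xi)\le 1$ for every unit simple tangent $p$-vector $\xi$ on $X$. $G(\phi)$ denotes the set of unit simple tangent $p$-vectors $\xi$ with $\phi(\xi)=1$ ($\phi$-planes). For $f\in C^\infty(X)$, the $\phi$-Hessian of $f$ is the $p$-form $\mathcal H^\phi(f)(v_1,\dots,v_p)=\sum_{i=1}^p\phi(v_1,\dots,\nabla_{v_i}(\nabla f),\dots,v_p)$ ($\nabla_{v_i}(\nabla f)$ in the $i$-th slot, $\nabla$ the Levi-Civita connection). $f$ is $\phi$-plurisubharmonic if $\mathcal H^\phi(f)(\xi)\ge 0$ for all $\xi\in G(\phi)$; $\mathcal{PSH}(X,\phi)$ is the set of all such smooth functions. For a compact set $K\subset X$, the $(X,\phi)$-convex hull is $\widehat K=\{x\in X: f(x)\le\sup_K f\ \text{for all } f\in\mathcal{PSH}(X,\phi)\}$. The notation $A\subset\subset X$ means that $A$ has compact closure in $X$; condition 1) is to be read for all compact $K\subset X$. A proper exhaustion function is a function $f:X\to\mathbb R$ such that $\{x\in X: f(x)\le c\}$ is compact for every $c\in\mathbb R$. *)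

(* Defs.v *)
From HB Require Import structures.
From mathcomp Require Import all_boot all_order all_algebra.
From mathcomp Require Import all_classical all_reals all_analysis.
From mathcomp Require Import ring lra.
Set Implicit Arguments.
Unset Strict Implicit.
Unset Printing Implicit Defensive.
Import Order.TTheory GRing.Theory Num.Theory.
Import numFieldNormedType.Exports.
Local Open Scope classical_set_scope.
Local Open Scope ring_scope.

(* C^oo on an open set U: all iterated directional derivatives (in particular
   all iterated partial derivatives) exist and are differentiable on U. *)
Definition smooth_on (R : realType) (n : nat) (W : normedModType R)
    (U : set 'rV[R]_n) (f : 'rV[R]_n -> W) : Prop :=
  forall (vs : seq 'rV[R]_n) (y : 'rV[R]_n), U y ->
    differentiable (foldr (fun v (h : 'rV[R]_n -> W) => 'D_v h) f vs) y.

Notation basis_vec j := (delta_mx 0 j).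

(* chart_map and chart_inv are total functions, mutually inverse homeomorphisms
   between the open sets chart_dom and chart_cod; their values elsewhere are
   irrelevant. *)
Record chart (R : realType) (X : topologicalType) (n : nat) := Chart {
  chart_dom : set X;
  chart_cod : set 'rV[R]_n;
  chart_map : X -> 'rV[R]_n;
  chart_inv : 'rV[R]_n -> X;
  chart_dom_open : open chart_dom;
  chart_cod_open : open chart_cod;
  chart_map_cod : forall x, chart_dom x -> chart_cod (chart_map x);
  chart_inv_dom : forall y, chart_cod y -> chart_dom (chart_inv y);
  chart_mapK : forall x, chart_dom x -> chart_inv (chart_map x) = x;
  chart_invK : forall y, chart_cod y -> chart_map (chart_inv y) = y;
  chart_map_continuous : forall x, chart_dom x -> {for x, continuous chart_map};
  chart_inv_continuous : forall y, chart_cod y -> {for y, continuous chart_inv}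
}.

Definition overlap (R : realType) (X : topologicalType) (n : nat)
    (c d : chart R X n) : set 'rV[R]_n :=
  [set y | chart_cod c y /\ chart_dom d (chart_inv c y)].

Definition transition (R : realType) (X : topologicalType) (n : nat)
    (c d : chart R X n) : 'rV[R]_n -> 'rV[R]_n :=
  chart_map d \o chart_inv c.

Record smooth_manifold (R : realType) (X : topologicalType) (n : nat) :=
  SmoothManifold {
  mfd_idx : Type;
  mfd_chart : mfd_idx -> chart R X n;
  mfd_cover : forall x, exists a, chart_dom (mfd_chart a) x;
  mfd_transition_smooth : forall a b,
    smooth_on (overlap (mfd_chart a) (mfd_chart b))
              (transition (mfd_chart a) (mfd_chart b));
  mfd_hausdorff : hausdorff_space X;
  mfd_second_countable : @second_countable X
}.

Arguments mfd_chart {R X n s} a.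

Definition mfd_cod (R : realType) (X : topologicalType) (n : nat)
    (M : smooth_manifold R X n) (a : mfd_idx M) : set 'rV[R]_n :=
  chart_cod (mfd_chart a).

Definition in_chart (R : realType) (X : topologicalType) (n : nat)
    (M : smooth_manifold R X n) (a : mfd_idx M) (f : X -> R) : 'rV[R]_n -> R :=
  f \o chart_inv (mfd_chart a).

Definition smooth_fun (R : realType) (X : topologicalType) (n : nat)
    (M : smooth_manifold R X n) (f : X -> R) : Prop :=
  forall a : mfd_idx M, smooth_on (mfd_cod a) (in_chart a f).

(* A tangent vector at the point with coordinates y in the chart a is
    given by its components v : 'rV_n in that chart; the components in the chart
    b are 'D_v (transition a b) y.  A tensor field is the family of its local
    expressions, subject to the corresponding transformation law.  A p-tuple of
    tangent vectors is the p x n matrix having them as rows. *)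

Record riemannian_metric (R : realType) (X : topologicalType) (n : nat)
    (M : smooth_manifold R X n) := RiemannianMetric {
  metric :> mfd_idx M -> 'rV[R]_n -> 'M[R]_n;
  metric_smooth : forall a, smooth_on (mfd_cod a) (metric a);
  metric_sym : forall a y, mfd_cod a y -> (metric a y)^T = metric a y;
  metric_pos : forall a y (v : 'rV[R]_n), mfd_cod a y -> v != 0 ->
    0 < (v *m metric a y *m v^T) 0 0;
  metric_change : forall a b y (v w : 'rV[R]_n),
    overlap (mfd_chart a) (mfd_chart b) y ->
    let t := transition (mfd_chart a) (mfd_chart b) in
    v *m metric a y *m w^T = 'D_v t y *m metric b (t y) *m ('D_w t y)^T
}.

Definition set_row (R : realType) (p n : nat) (i : 'I_p) (u : 'rV[R]_n)
    (V : 'M[R]_(p, n)) : 'M[R]_(p, n) :=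
  \matrix_(j < p) (if j == i then u else row j V).

Definition multilinear_rows (R : realType) (p n : nat)
    (w : 'M[R]_(p, n) -> R) : Prop :=
  forall (i : 'I_p) (c : R) (u v : 'rV[R]_n) (V : 'M[R]_(p, n)),
    w (set_row i (c *: u + v) V) = c * w (set_row i u V) + w (set_row i v V).

Definition alternating_rows (R : realType) (p n : nat)
    (w : 'M[R]_(p, n) -> R) : Prop :=
  forall (V : 'M[R]_(p, n)) (i j : 'I_p),
    i != j -> row i V = row j V -> w V = 0.

Record diff_form (R : realType) (X : topologicalType) (n : nat)
    (M : smooth_manifold R X n) (p : nat) := DiffForm {
  form :> mfd_idx M -> 'rV[R]_n -> 'M[R]_(p, n) -> R;
  form_multilinear : forall a y, mfd_cod a y -> multilinear_rows (form a y);
  form_alternating : forall a y, mfd_cod a y -> alternating_rows (form a y);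
  form_smooth : forall a (V : 'M[R]_(p, n)),
    smooth_on (mfd_cod a) (fun y => form a y V);
  form_change : forall a b y (V : 'M[R]_(p, n)),
    overlap (mfd_chart a) (mfd_chart b) y ->
    let t := transition (mfd_chart a) (mfd_chart b) in
    form a y V = form b (t y) (\matrix_(i < p) 'D_(row i V) t y)
}.

(* The invariant formula for d evaluated on constant (hence commuting)
   coordinate fields; row' i deletes the i-th vector. *)
Definition ext_deriv (R : realType) (X : topologicalType) (n : nat)
    (M : smooth_manifold R X n) (p : nat) (phi : diff_form M p)
    (a : mfd_idx M) (y : 'rV[R]_n) (V : 'M[R]_(p.+1, n)) : R :=
  \sum_(i < p.+1)
     (-1) ^+ i * 'D_(row i V) (fun z => phi a z (row' i V)) y.

Definition closed_form (R : realType) (X : topologicalType) (n : nat)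
    (M : smooth_manifold R X n) (p : nat) (phi : diff_form M p) : Prop :=
  forall (a : mfd_idx M) y V, mfd_cod a y -> ext_deriv phi a y V = 0.

(* The simple p-vector v_1 /\ ... /\ v_p is represented by the matrix V with
   rows v_i: its squared norm is the Gram determinant det (<v_i, v_j>), and the
   value of a p-form on it is the value on (v_1, ..., v_p). *)
Definition unit_simple (R : realType) (X : topologicalType) (n : nat)
    (M : smooth_manifold R X n) (g : riemannian_metric M) (p : nat)
    (a : mfd_idx M) (y : 'rV[R]_n) (V : 'M[R]_(p, n)) : Prop :=
  \det (V *m g a y *m V^T) = 1.

Definition calibration (R : realType) (X : topologicalType) (n : nat)
    (M : smooth_manifold R X n) (g : riemannian_metric M) (p : nat)
    (phi : diff_form M p) : Prop :=
  closed_form phi /\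
  forall (a : mfd_idx M) y V,
    mfd_cod a y -> unit_simple g a y V -> phi a y V <= 1.

Definition phi_plane (R : realType) (X : topologicalType) (n : nat)
    (M : smooth_manifold R X n) (g : riemannian_metric M) (p : nat)
    (phi : diff_form M p) (a : mfd_idx M) (y : 'rV[R]_n)
    (V : 'M[R]_(p, n)) : Prop :=
  unit_simple g a y V /\ phi a y V = 1.

(* Gamma^k_ij: k is the contravariant index. *)
Definition christoffel (R : realType) (X : topologicalType) (n : nat)
    (M : smooth_manifold R X n) (g : riemannian_metric M) (a : mfd_idx M)
    (y : 'rV[R]_n) (k i j : 'I_n) : R :=
  2^-1 * \sum_(l < n) invmx (g a y) k l *
    ('D_(basis_vec i) (fun z => g a z j l) y
     + 'D_(basis_vec j) (fun z => g a z i l) y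
     - 'D_(basis_vec l) (fun z => g a z i j) y).

Lemma metric_unit (R : realType) (X : topologicalType) (n : nat)
    (M : smooth_manifold R X n) (g : riemannian_metric M) (a : mfd_idx M)
    (y : 'rV[R]_n) :
  mfd_cod a y -> g a y \in unitmx.
Proof.
move=> ay; rewrite -row_free_unit -kermx_eq0; apply/eqP/row_matrixP => i.
apply/eqP; rewrite row0; apply/negPn/negP => ri0.
have := metric_pos g ay ri0.
by rewrite -row_mul mulmx_ker row0 mul0mx mxE ltxx.
Qed.

(* The Christoffel symbols are the coefficients of the unique connection that
   is torsion-free and compatible with the metric. *)
Lemma christoffelP (R : realType) (X : topologicalType) (n : nat)
    (M : smooth_manifold R X n) (g : riemannian_metric M) (a : mfd_idx M)
    (y : 'rV[R]_n) (Gamma : 'I_n -> 'I_n -> 'I_n -> R) :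
  mfd_cod a y ->
  ((forall k i j, Gamma k i j = Gamma k j i) /\
   (forall k i j, 'D_(basis_vec k) (fun z => g a z i j) y =
      \sum_(l < n) (Gamma l k i * g a y l j + Gamma l k j * g a y i l)))
  <-> forall k i j, Gamma k i j = christoffel g a y k i j.
Proof.
move=> ay; set G := g a y.
have Gu : G \in unitmx by exact: metric_unit.
have Gs i j : G i j = G j i.
  by have /matrixP/(_ j i) := metric_sym g ay; rewrite mxE.
pose D k i j := 'D_(basis_vec k) (fun z => g a z i j) y.
have Ds k i j : D k i j = D k j i.
  rewrite /D; apply: near_eq_derive.
  near=> z; have /(metric_sym g)/matrixP/(_ j i) : mfd_cod a z.
    by near: z; apply: open_nbhs_nbhs; split=> //; exact: chart_cod_open.
  by rewrite mxE.
have lowerE (Ga : 'I_n -> 'I_n -> 'I_n -> R) (B : 'I_n -> 'I_n -> 'I_n -> R) :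
    (forall i j m, \sum_(l < n) Ga l i j * G l m = B i j m) <->
    (forall k i j, Ga k i j = \sum_(l < n) invmx G k l * B i j l).
  have invs k l : invmx G k l = invmx G l k.
    have GT : G^T = G by apply/matrixP=> i j; rewrite mxE.
    by have := trmx_inv G; rewrite GT => /matrixP/(_ k l); rewrite mxE => ->.
  have rowE i j : (\row_l Ga l i j) *m G = \row_l B i j l <->
      \row_l Ga l i j = (\row_l B i j l) *m invmx G.
    by split=> [<-|->]; rewrite ?mulmxK ?mulmxKV.
  split=> H.
  - move=> k i j; have /rowE/matrixP/(_ 0 k) :
        (\row_l Ga l i j) *m G = \row_l B i j l.
      by apply/rowP => m; rewrite !mxE -H; apply: eq_bigr => l _; rewrite mxE.
    rewrite !mxE => ->; apply: eq_bigr => l _.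
    by rewrite mxE mulrC invs.
  - move=> i j m; have /rowE/matrixP/(_ 0 m) :
        \row_l Ga l i j = (\row_l B i j l) *m invmx G.
      apply/rowP => k; rewrite !mxE H; apply: eq_bigr => l _.
      by rewrite mxE mulrC invs.
    by rewrite !mxE => <-; apply: eq_bigr => l _; rewrite mxE.
pose B i j l := 2^-1 * (D i j l + D j i l - D l i j).
have chE k i j : christoffel g a y k i j = \sum_(l < n) invmx G k l * B i j l.
  by rewrite /christoffel mulr_sumr; apply: eq_bigr => l _; rewrite mulrCA.
have compE k i j : \sum_(l < n) (Gamma l k i * g a y l j + Gamma l k j * g a y i l)
    = \sum_(l < n) Gamma l k i * G l j + \sum_(l < n) Gamma l k j * G l i.
  by rewrite big_split; congr (_ + _); apply: eq_bigr => l _; rewrite -/G (Gs i).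
split=> [[sym comp] k i j|H].
  rewrite chE; apply (lowerE Gamma B) => {k i j} i j m.
  set S := fun i j m => \sum_(l < n) Gamma l i j * G l m.
  have Ss u v w : S u v w = S v u w by apply: eq_bigr => l _; rewrite sym.
  have DE u v w : D u v w = S u v w + S u w v by rewrite /D comp compE.
  rewrite -/(S i j m) /B !DE (Ss j i) (Ss m i) (Ss m j); lra.
have {}H : forall i j m, \sum_(l < n) Gamma l i j * G l m = B i j m.
  by apply/lowerE => k i j; rewrite H chE.
have Bs i j m : B i j m = B j i m by rewrite /B (Ds m i j) (addrC (D i j m)).
split=> [k i j|k i j].
  have HG := (lowerE Gamma B).1 H.
  by rewrite !HG; apply: eq_bigr => l _; rewrite Bs.
rewrite compE !H -/(D k i j) /B (Ds k j i); lra.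
Unshelve. all: by end_near. Qed.

(* nabla_v W at y, for a vector field with components W in the chart a *)
Definition covariant_deriv (R : realType) (X : topologicalType) (n : nat)
    (M : smooth_manifold R X n) (g : riemannian_metric M) (a : mfd_idx M)
    (y v : 'rV[R]_n) (W : 'rV[R]_n -> 'rV[R]_n) : 'rV[R]_n :=
  'D_v W y +
  \row_(k < n) \sum_(i < n) \sum_(j < n)
    christoffel g a y k i j * v 0 i * W y 0 j.

Definition gradient (R : realType) (X : topologicalType) (n : nat)
    (M : smooth_manifold R X n) (g : riemannian_metric M) (a : mfd_idx M)
    (f : X -> R) (y : 'rV[R]_n) : 'rV[R]_n :=
  (\row_(j < n) 'D_(basis_vec j) (in_chart a f) y) *m invmx (g a y).

Definition phi_hessian (R : realType) (X : topologicalType) (n : nat)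
    (M : smooth_manifold R X n) (g : riemannian_metric M) (p : nat)
    (phi : diff_form M p) (f : X -> R) (a : mfd_idx M) (y : 'rV[R]_n)
    (V : 'M[R]_(p, n)) : R :=
  \sum_(i < p)
    phi a y (set_row i (covariant_deriv g a y (row i V) (gradient g a f)) V).

Definition psh (R : realType) (X : topologicalType) (n : nat)
    (M : smooth_manifold R X n) (g : riemannian_metric M) (p : nat)
    (phi : diff_form M p) (f : X -> R) : Prop :=
  smooth_fun M f /\
  forall (a : mfd_idx M) y V,
    mfd_cod a y -> phi_plane g phi a y V -> 0 <= phi_hessian g phi f a y V.

(* The supremum is taken in \bar R, so that the hull of set0 is set0. *)
Definition convex_hull (R : realType) (X : topologicalType) (n : nat)
    (M : smooth_manifold R X n) (g : riemannian_metric M) (p : nat)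
    (phi : diff_form M p) (K : set X) : set X :=
  [set x | forall f : X -> R, psh g phi f ->
     ((f x)%:E <= ereal_sup [set (f y)%:E | y in K])%E].

Definition relatively_compact (X : topologicalType) (A : set X) : Prop :=
  compact (closure A).

Definition proper_exhaustion (R : realType) (X : topologicalType)
    (f : X -> R) : Prop :=
  forall c : R, compact [set x | f x <= c].

(* Main.v *)
Require Import Defs.
From mathcomp Require Import all_boot all_order all_algebra.
From mathcomp Require Import all_classical all_reals all_analysis.
From mathcomp Require Import ring lra.
Import Order.TTheory GRing.Theory Num.Theory.
Import numFieldNormedType.Exports.

(** A proper exhaustion forces convexity at once: if f is plurisubharmonic with
    compact sublevel sets and f <= c on K, then the hull of K lies in the
    compact set of points where f <= c.

    Conversely, suppose that hulls of compact sets are relatively compact.  As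
    a manifold is locally compact with a countable base, it is exhausted by
    compact sets C_0 = set0, C_1, C_2, ... such that the interior of C_(m+1)
    contains both C_m and the hull of C_m ([compact_exhaustion]).  A point x
    outside the hull of C_m is separated from C_m by a plurisubharmonic h, say
    h <= c on C_m and c < h x.  Compose h - c with a large multiple of
    chi t = t exp (- 1 / t), extended by 0 to t <= 0, which is smooth, convex
    and nondecreasing; the result is plurisubharmonic, nonnegative, zero on C_m
    and larger than m near x ([separating_psh]).  Since C_(m+2) minus the
    interior of C_(m+1) is compact and disjoint from the hull of C_m, finitely
    many such functions add up to a k_m that exceeds m on all of it
    ([separating_psh_compact]).  The sum of all the k_m is locally finite, as
    k_j vanishes on C_m for j >= m; hence it is plurisubharmonic, and it exceeds
    m outside C_(m+1), so that it is proper.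

    The geometric point is that composition with a convex nondecreasing chi
    preserves plurisubharmonicity ([psh_comp]).  The Hessian of chi o f is
    chi'(f) times that of f, plus chi''(f) times
    sum_i <v_i, grad f> phi (v_1, ..., grad f, ..., v_p), with grad f in the
    i-th slot.  On a phi-plane the last sum equals the squared length of the
    projection of grad f onto the plane ([calibrated_rank_one_ge0]).  The
    tangential part of grad f accounts for this value.  The normal part
    contributes nothing: among unit simple p-vectors, phi is maximal at a
    phi-plane, hence stationary there, so it vanishes when one of the v_i is
    replaced with a normal vector ([first_cousin]). *)

Local Open Scope classical_set_scope.
Local Open Scope ring_scope.

Set Implicit Arguments.
Unset Strict Implicit.

(** * Smooth functions *)

(** [g - f] vanishes near [x], so the zero map is its differential there. *)
Lemma near_eq_differentiable (R : realType) (V W : normedModType R)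
    (f g : V -> W) (x : V) :
  {near x, f =1 g} -> differentiable f x -> differentiable g x.
Proof.
move=> fg df.
suff dh : differentiable (g - f) x.
  by rewrite -(subrK f g); exact: differentiableD.
have h0 : \forall z \near x, g z - f z = 0.
  by near=> z; rewrite (near fg z)// subrr.
have E : (g - f) \o shift x = cst ((g - f) x) + (\0 : V -> W) +o_ 0 id.
  apply/eqaddoP => _/posnumP[e].
  have gfx : (g - f) x = 0 by exact: nbhs_singleton h0.
  rewrite gfx.
  move: h0; rewrite (near_shift 0 x) /= subr0 => h0.
  near=> z.
  have -> : ((g - f) \o shift x - (cst 0 + (\0 : V -> W))) z = 0.
    rewrite !fctE/= addr0 subr0.
    by apply: (near h0 z).
  by rewrite normr0 mulr_ge0.
have c0 : continuous (\0 : V -> W) by exact: cst_continuous.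
by apply/diff_locallyP; rewrite (diff_unique c0 E).
Unshelve. all: by end_near. Qed.

(** Here the successive derivatives are peeled off from the inside, whereas
    [smooth_on] adds them on the outside: the Leibniz and chain rules rewrite
    the innermost derivative, so products and compositions can be handled by
    induction on [k]. *)
Fixpoint ndiff_on (R : realType) (n : nat) (k : nat) (U : set 'rV[R]_n)
    (f : 'rV[R]_n -> R) : Prop :=
  (forall y, U y -> differentiable f y) /\
  if k is k'.+1 then forall v, ndiff_on k' U ('D_v f) else True.

Lemma smooth_on_ndiff (R : realType) (n : nat) (U : set 'rV[R]_n)
    (f : 'rV[R]_n -> R) :
  smooth_on U f <-> forall k, ndiff_on k U f.
Proof.
split=> [sf k|sf vs].
  elim: k f sf => [|k IH] f sf; split=> //; try exact: (sf [::]).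
  by move=> v; apply: IH => vs; have := sf (rcons vs v); rewrite foldr_rcons.
elim/last_ind: vs f sf => [|vs v IH] f sf; first by case: (sf 0).
rewrite foldr_rcons; apply: IH => k.
by have [_] := sf k.+1; exact.
Qed.

Lemma ndiff_onW (R : realType) (n k : nat) (U : set 'rV[R]_n) f :
  ndiff_on k.+1 U f -> ndiff_on k U f.
Proof.
elim: k f => [|k IH] f [df dDf]; split=> // v.
by apply: IH; exact: dDf.
Qed.

Section open_set.
Context (R : realType) (n : nat) (U : set 'rV[R]_n).
Hypothesis Uo : open U.
Implicit Types f g : 'rV[R]_n -> R.

Lemma near_open y : U y -> \forall z \near y, U z.
Proof. by move=> Uy; apply: open_nbhs_nbhs. Qed.

(** The Leibniz and chain rules below hold only on [U]; this is what allows a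
    derivative to be replaced with the expression that they give. *)
Lemma eq_ndiff_on k f g : (forall y, U y -> f y = g y) ->
  ndiff_on k U f -> ndiff_on k U g.
Proof.
elim: k f g => [|k IH] f g fg [df dDf].
  split=> // y Uy; apply: near_eq_differentiable (df y Uy).
  by apply: filterS (near_open Uy) => z /fg.
split=> [y Uy|v].
  apply: near_eq_differentiable (df y Uy).
  by apply: filterS (near_open Uy) => z /fg.
apply: IH (dDf v) => y Uy; apply: near_eq_derive.
by apply: filterS (near_open Uy) => z /fg.
Qed.

Lemma ndiff_on_cst k (c : R) : ndiff_on k U (cst c).
Proof.
elim: k c => [|k IH] c; split=> // v.
apply: eq_ndiff_on (IH 0) => y _; by rewrite derive_cst.
Qed.

Lemma ndiff_onD k f g : ndiff_on k U f -> ndiff_on k U g ->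
  ndiff_on k U (f + g).
Proof.
elim: k f g => [|k IH] f g [df dDf] [dg dDg].
  by split=> // y Uy; apply: differentiableD; [exact: df|exact: dg].
split=> [y Uy|v]; first by apply: differentiableD; [exact: df|exact: dg].
apply: eq_ndiff_on (IH _ _ (dDf v) (dDg v)) => y Uy.
by rewrite deriveD//; apply: diff_derivable; [exact: df|exact: dg].
Qed.

Lemma ndiff_onM k f g : ndiff_on k U f -> ndiff_on k U g ->
  ndiff_on k U (f * g).
Proof.
elim: k f g => [|k IH] f g.
  move=> [df _] [dg _].
  by split=> // y Uy; apply: differentiableM; [exact: df|exact: dg].
move=> nf ng; have [df dDf] := nf; have [dg dDg] := ng.
split=> [y Uy|v]; first by apply: differentiableM; [exact: df|exact: dg].
have := ndiff_onD (IH _ _ (ndiff_onW nf) (dDg v)) (IH _ _ (ndiff_onW ng) (dDf v)).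
apply: eq_ndiff_on => y Uy.
by rewrite deriveM//; apply: diff_derivable; [exact: df|exact: dg].
Qed.

Lemma derive_comp (chi : R -> R) chi' f y v :
  differentiable f y -> is_derive (f y) (1 : R) chi chi' ->
  differentiable (chi \o f) y /\ 'D_v (chi \o f) y = chi' * 'D_v f y.
Proof.
move=> df [/derivable1_diffP dchi <-]; split.
  exact: differentiable_comp.
rewrite !deriveE//; last exact: differentiable_comp.
rewrite diff_comp//= -[in LHS](mulr1 ('d f y v)).
by rewrite -[_ * 1]/(_ *: 1) linearZ /= mulrC.
Qed.

(** The derivative of [chi i \o f] involves [chi i.+1 \o f], so the induction
    has to range over the whole sequence of derivatives of [chi 0]. *)
Lemma ndiff_on_comp k (chi : nat -> R -> R) i f :
  (forall j t, is_derive (t : R) (1 : R) (chi j) (chi j.+1 t)) ->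
  ndiff_on k U f -> ndiff_on k U (chi i \o f).
Proof.
move=> dchi; elim: k i => [|k IH] i nf.
  case: nf => df _; split=> // y Uy.
  by have [] := derive_comp 0 (df y Uy) (dchi i (f y)).
have [df dDf] := nf; split=> [y Uy|v].
  by have [] := derive_comp 0 (df y Uy) (dchi i (f y)).
apply: eq_ndiff_on (ndiff_onM (IH i.+1 (ndiff_onW nf)) (dDf v)) => y Uy.
by have [_ ->] := derive_comp v (df y Uy) (dchi i (f y)).
Qed.

Lemma smooth_on_cst (c : R) : smooth_on U (cst c).
Proof. by apply/smooth_on_ndiff => k; exact: ndiff_on_cst. Qed.

Lemma smooth_onD f g : smooth_on U f -> smooth_on U g -> smooth_on U (f + g).
Proof.
move=> /smooth_on_ndiff sf /smooth_on_ndiff sg; apply/smooth_on_ndiff => k.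
exact: ndiff_onD.
Qed.

Lemma smooth_on_comp (chi : nat -> R -> R) i f :
  (forall j t, is_derive (t : R) (1 : R) (chi j) (chi j.+1 t)) ->
  smooth_on U f -> smooth_on U (chi i \o f).
Proof.
move=> dchi /smooth_on_ndiff sf; apply/smooth_on_ndiff => k.
exact: ndiff_on_comp.
Qed.

Lemma smooth_on_differentiable f y : smooth_on U f -> U y -> differentiable f y.
Proof. by move=> sf; exact: (sf [::]). Qed.

Lemma smooth_on_derive f v : smooth_on U f -> smooth_on U ('D_v f).
Proof. by move=> sf vs; have := sf (rcons vs v); rewrite foldr_rcons. Qed.

End open_set.

(** * A smooth convex function vanishing on the negative half-line *)

Section flat_functions.
Context (R : realType).
Implicit Types (P : {poly R}) (t : R).

(** Functions of this form are stable under differentiation, which makes their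
    smoothness at the junction point 0 a single computation. *)
Definition flat P t : R := if 0 < t then P.[t^-1] * expR (- t^-1) else 0.

(** With s = 1 / t one has ds/dt = - s ^ 2, so P(s) exp(-s) has derivative
    s ^ 2 (P - P')(s) exp(-s) in t. *)
Definition flat_deriv P : {poly R} := 'X ^+ 2 * (P - P^`()).

(** The power [s ^+ j] gives the induction on [P] the room it needs: writing
    [P] as Q X + c shifts it to [j.+1]. *)
Lemma poly_expRN_bounded P j :
  exists2 C : R, 0 <= C & forall s, 0 <= s -> `|P.[s]| * s ^+ j * expR (- s) <= C.
Proof.
elim/poly_ind: P j => [|P c IH] j.
  by exists 0 => // s s0; rewrite horner0 normr0 !mul0r.
have [C C0 hC] := IH j.+1.
exists (C + `|c| * j.+1`!%:R) => [|s s0]; first by rewrite addr_ge0 ?mulr_ge0.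
rewrite !hornerE.
have e0 : 0 <= expR (- s) by exact: expR_ge0.
(* For j > 0 compare s ^ j with the j-th term of the exponential series. *)
have h : s ^+ j * expR (- s) <= j.+1`!%:R.
  case: j {hC} => [|j].
    rewrite expr0 mul1r factS fact0 -[leRHS]expR0 ler_expR; lra.
  have f0 : 0 < (j.+1`!%:R : R) by rewrite ltr0n fact_gt0.
  have h2 : (j.+1`!%:R : R) <= j.+2`!%:R by rewrite ler_nat factS leq_pmull.
  have h3 : s ^+ j.+1 / j.+1`!%:R <= expR s by have := expR_ge1Dxn j s0; lra.
  rewrite expRN ler_pdivrMr ?expR_gt0//.
  move: h3; rewrite ler_pdivrMr// mulrC => /le_trans; apply.
  by rewrite ler_wpM2r ?expR_ge0.
apply: (@le_trans _ _ ((`|P.[s]| * s + `|c|) * s ^+ j * expR (- s))).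
  rewrite !ler_wpM2r ?exprn_ge0//.
  by apply: (le_trans (ler_normD _ _)); rewrite normrM (ger0_norm s0).
rewrite mulrDl mulrDl lerD//.
  by have := hC s s0; rewrite exprS !mulrA.
by rewrite -mulrA ler_wpM2l.
Qed.

(** With s = 1 / t this is the boundedness of s ^ 2 P(s) exp(-s). *)
Lemma flat_quadratic P : exists2 C : R, 0 <= C & forall t, `|flat P t| <= C * t ^+ 2.
Proof.
have [C C0 hC] := poly_expRN_bounded P 2.
exists C => // t; rewrite /flat; case: ifPn => [t0|_]; last first.
  by rewrite normr0 mulr_ge0 ?sqr_ge0.
have := hC t^-1; rewrite invr_ge0 (ltW t0) => /(_ isT).
rewrite normrM (ger0_norm (expR_ge0 _)).
rewrite -mulrA [_^-1 ^+ _ * _]mulrC mulrA exprVn ler_pdivrMr//.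
by rewrite exprn_gt0.
Qed.

Lemma is_derive_quadratic0 (f : R -> R) (C : R) :
  (forall t, `|f t| <= C * t ^+ 2) -> is_derive (0 : R) (1 : R) f 0.
Proof.
move=> fC.
have f0 : f 0 = 0.
  apply/eqP; rewrite -normr_le0.
  by have := fC 0; rewrite expr0n /= mulr0.
suff h : h^-1 *: (f (h *: 1 + 0) - f 0) @[h --> (0 : R)^'] --> (0 : R).
  by apply: DeriveDef; [apply/cvg_ex; exists 0|apply/cvg_lim].
apply/cvgrPdist_le => /= e e0.
near=> t.
have t0 : t != 0 by near: t; exact: nbhs_dnbhs_neq.
rewrite f0 addr0 subr0 sub0r normrN /GRing.scale /= mulr1 normrM normfV.
rewrite mulrC ler_pdivrMr ?normr_gt0//.
apply: (le_trans (fC t)); rewrite -[t ^+ 2]ger0_norm ?sqr_ge0// normrX expr2 mulrA.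
rewrite ler_wpM2r//.
have C1 : 0 < `|C| + 1 by rewrite ltr_wpDl.
have : `|t| <= e / (`|C| + 1).
  by near: t; apply: dnbhs0_le; rewrite divr_gt0.
rewrite ler_pdivlMr// => h; apply: le_trans h.
rewrite mulrC ler_wpM2l//; have := ler_norm C; lra.
Unshelve. all: by end_near. Qed.

(** Only t = 0 is not a matter of differentiation rules; there the derivative
    is 0 because [flat P] is at most quadratic. *)
Lemma is_derive_flat P t : is_derive t (1 : R) (flat P) (flat (flat_deriv P) t).
Proof.
have [t0|t0|t0] := ltgtP t 0; last first.
- rewrite t0 {2}/flat ltxx; have [C _ hC] := flat_quadratic P.
  exact: is_derive_quadratic0 hC.
- apply: (@near_eq_is_derive _ R^o R^o (fun u => P.[u^-1] * expR (- u^-1))).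
    near=> u; rewrite /flat ifT//; near: u; exact: lt_nbhsr.
  have tn0 : t != 0 by rewrite gt_eqF.
  have dV : is_derive t (1 : R) (fun u : R => u^-1) (- t ^- 2).
    apply: DeriveDef; first exact: (@derivableV _ R^o id).
    by rewrite (@deriveV _ R^o id)// derive_id /GRing.scale /= mulr1.
  have dP : is_derive t (1 : R) (fun u => P.[u^-1]) (- t ^- 2 * P^`().[t^-1]).
    have := @is_derive1_comp R (horner P) (fun u => u^-1) t _ _
      (is_derive_poly P t^-1) dV.
    by move=> h; apply: is_derive_eq h _; exact: mulrC.
  have dE : is_derive t (1 : R) (fun u : R => expR (- u^-1))
      (t ^- 2 * expR (- t^-1)).
    have := @is_derive1_comp R expR (fun u => - u^-1) t _ _
      (is_derive_expR _) (is_deriveN dV).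
    by move=> h; apply: is_derive_eq h _; rewrite opprK; exact: mulrC.
  apply: is_derive_eq (is_deriveM dP dE) _.
  rewrite /flat t0 /flat_deriv !hornerE /GRing.scale /= exprVn; ring.
- apply: (@near_eq_is_derive _ R^o R^o (cst 0)).
    near=> u; rewrite /flat ifN// -leNgt ltW//.
    by near: u; exact: lt_nbhsl.
  by rewrite /flat ltNge (ltW t0) /=; exact: is_derive_cst.
Unshelve. all: by end_near. Qed.

(** [chi j] is the [j]-th derivative of t exp(- 1 / t), extended by 0.  The
    factor t is there for convexity: exp(- 1 / t) is increasing and bounded on
    the half-line, hence not convex.  The first derivative is
    (1 + 1 / t) exp(- 1 / t), whence the polynomial [1 + 'X]. *)
Definition chi (j : nat) : R -> R :=
  if j is i.+1 then flat (iter i flat_deriv (1 + 'X)) else fun t => t * flat 1 t.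

Lemma is_derive_chi j t : is_derive t (1 : R) (chi j) (chi j.+1 t).
Proof.
case: j => [|j] /=; last exact: is_derive_flat.
apply: is_derive_eq (is_deriveM (is_derive_id t 1) (is_derive_flat 1 t)) _.
rewrite /flat /flat_deriv /GRing.scale /= !hornerE derivC.
case: ifPn => t0; last by rewrite !mulr0 addr0.
rewrite !hornerE /= subr0; field.
by rewrite gt_eqF.
Qed.

Lemma chi_le0 t : t <= 0 -> chi 0 t = 0.
Proof. by move=> t0; rewrite /chi /flat ltNge t0 /= mulr0. Qed.

Lemma chi_gt0 t : 0 < t -> 0 < chi 0 t.
Proof.
move=> t0; rewrite /chi /flat t0 !hornerE /=.
by rewrite mulr1 mulr_gt0 ?expR_gt0.
Qed.

Lemma chi1_ge0 t : 0 <= chi 1 t.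
Proof.
rewrite /chi /= /flat; case: ifPn => // t0; rewrite !hornerE mulr_ge0 ?expR_ge0//.
by rewrite addr_ge0// invr_ge0 ltW.
Qed.

(** With s = 1 / t the second derivative is s ^ 3 exp(-s). *)
Lemma chi2_ge0 t : 0 <= chi 2 t.
Proof.
rewrite /chi /= /flat; case: ifPn => // t0.
rewrite /flat_deriv derivD derivC derivX !hornerE mulr_ge0 ?expR_ge0//.
have s0 : 0 <= t^-1 by rewrite invr_ge0 ltW.
rewrite mulr_ge0 ?sqr_ge0//; lra.
Qed.

End flat_functions.
Arguments chi {R} j : simpl never.

(** * Compact exhaustions *)

Section exhaustion.
Context (X : topologicalType).
Implicit Types K A B : set X.

(** Local-to-global principle on a compact set.  If [P K] failed, the sets [A]
    such that [P (K `\` A)] would form a proper filter containing [K]; it would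
    cluster at some point [x] of [K], although the complement of a neighborhood
    of [x] satisfying [P] belongs to it. *)
Lemma compact_induction K (P : set X -> Prop) : compact K ->
  P set0 ->
  (forall A B, P A -> P B -> P (A `|` B)) ->
  (forall A B, A `<=` B -> P B -> P A) ->
  (forall x, K x -> exists2 U, nbhs x U & P U) ->
  P K.
Proof.
move=> cK P0 PU PW PK; apply: contrapT => nPK.
pose F : set_system X := [set A | P (K `\` A)].
have FF : ProperFilter F.
  split; first by rewrite /F /= setD0.
  split.
  - by rewrite /F /= setDT.
  - by move=> A B FA FB; rewrite /F /= setDIr; exact: PU.
  - by move=> A B AB; apply: PW; exact: setDS.
have FK : F K by rewrite /F /= setDv.
have [x [Kx clx]] := cK F FF FK.
have [U Ux PUU] := PK x Kx.
have FU : F (~` U) by apply: PW PUU => y [_ /contrapT].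
by have [y []] := clx _ _ FU Ux.
Qed.

(** The basic open sets with compact closure already cover the space. *)
Lemma countable_compact_cover :
  hausdorff_space X -> @second_countable X ->
  (forall x : X, exists2 K, compact K & nbhs x K) ->
  exists L : nat -> set X, (forall k, compact (L k)) /\ forall x, exists k, L k x.
Proof.
move=> hX [B cB [_ Bx]] lcX.
have /pfcard_geP[B0|[f]] := cB.
  exists (fun=> set0); split=> [_|x]; first exact: compact0.
  by have [U []] := Bx x setT filterT; rewrite B0.
exists (fun k => [set x | compact (closure (f k)) /\ closure (f k) x]).
split=> [k|x].
  have [cf|ncf] := pselect (compact (closure (f k))).
    rewrite (_ : [set _ | _] = closure (f k))//.
    by apply/seteqP; split=> x // [].
  rewrite (_ : [set _ | _] = set0); first exact: compact0.
  by apply/seteqP; split=> x // [].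
have [K cK Kx] := lcX x.
have [U [BU Ux] UK] := Bx x K Kx.
have [k _ fk] := @surj _ _ _ _ f U BU.
exists k; rewrite /= fk; split; last exact: subset_closure.
apply: (subclosed_compact _ cK); first exact: closed_closure.
have /closure_id -> := compact_closed hX cK; exact: closureS.
Qed.

Lemma compact_neighborhood K :
  (forall x : X, exists2 K, compact K & nbhs x K) ->
  compact K -> exists2 L, compact L & K `<=` L°.
Proof.
move=> lcX cK.
apply: (compact_induction (P := fun A => exists2 L, compact L & A `<=` L°) cK).
- by exists set0 => //; exact: compact0.
- move=> A B [L cL AL] [L' cL' BL']; exists (L `|` L'); first exact: compactU.
  move=> x [/AL|/BL'] h; apply: filterS h => y; by [left|right].
- by move=> A B AB [L cL BL]; exists L => //; exact: subset_trans BL.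
- move=> x _; have [L cL Lx] := lcX x; exists L°; last by exists L.
  exact: nbhs_interior.
Qed.

(** [C m.+1] is a compact neighborhood of the union of [C m], the closure of
    [H (C m)] and the [m]-th set of a countable compact cover. *)
Lemma compact_exhaustion (H : set X -> set X) :
  hausdorff_space X -> @second_countable X ->
  (forall x : X, exists2 K, compact K & nbhs x K) ->
  (forall K, compact K -> relatively_compact (H K)) ->
  exists C : nat -> set X, [/\ C 0 = set0, forall m, compact (C m),
    forall m, C m `<=` (C m.+1)°,
    forall m, H (C m) `<=` (C m.+1)° & forall x, exists m, C m x].
Proof.
move=> hX scX lcX Hc.
have [L [cL Lx]] := countable_compact_cover hX scX lcX.
have /choice[N hN] : forall K, exists L, compact K -> compact L /\ K `<=` L°.
  move=> K; have [cK|ncK] := pselect (compact K); last by exists set0.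
  by have [L' cL' KL'] := compact_neighborhood lcX cK; exists L'.
pose C := fix C m := if m is k.+1 then N (C k `|` closure (H (C k)) `|` L k)
  else set0.
have cC m : compact (C m).
  elim: m => [|m IH]; first exact: compact0.
  have /hN[] // : compact (C m `|` closure (H (C m)) `|` L m).
  by apply: compactU => //; apply: compactU => //; exact: Hc.
have CN m : C m `|` closure (H (C m)) `|` L m `<=` (C m.+1)°.
  have /hN[] // : compact (C m `|` closure (H (C m)) `|` L m).
  by apply: compactU => //; apply: compactU => //; exact: Hc.
exists C; split => //.
- by move=> m x Cx; apply: CN; left; left.
- by move=> m x Cx; apply: CN; left; right; exact: subset_closure.
- move=> x; have [k Lk] := Lx x; exists k.+1; apply: interior_subset.
  by apply: CN; right.
Qed.

End exhaustion.

Section manifold_topology.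
Context (R : realType) (X : topologicalType) (n : nat).

(** The image under [chart_inv] of a small closed ball of coordinates. *)
Lemma chart_compact_nbhs (c : chart R X n) x : chart_dom c x ->
  exists2 K : set X, compact K & nbhs x K.
Proof.
move=> cx; set y := chart_map c x.
have cody : nbhs y (chart_cod c).
  apply: open_nbhs_nbhs; split; first exact: chart_cod_open.
  exact: chart_map_cod.
have /nbhs_closedballP[r rc] := cody.
exists (chart_inv c @` closed_ball y r%:num).
  apply: continuous_compact.
    apply: continuous_in_subspaceT => z /set_mem zr.
    exact/chart_inv_continuous/rc.
  apply: bounded_closed_compact; last exact: closed_ball_closed.
  exists (`|y| + r%:num); split; first exact: num_real.
  move=> M yrM z; rewrite closed_ballE// /closed_ball_ /= => yz.
  rewrite -(subrK y z) (le_trans (ler_normD _ _))// (le_trans _ (ltW yrM))//.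
  by rewrite addrC lerD2l distrC.
have h1 : nbhs x (chart_dom c)
  by apply: open_nbhs_nbhs; split=> //; exact: chart_dom_open.
have h2 : nbhs x (chart_map c @^-1` closed_ball y r%:num).
  by apply: (chart_map_continuous cx); by apply/nbhs_closedballP; exists r.
apply: filterS (filterI h1 h2) => z [dz bz].
by exists (chart_map c z) => //; exact: chart_mapK.
Qed.

Lemma manifold_compact_nbhs (M : smooth_manifold R X n) (x : X) :
  exists2 K : set X, compact K & nbhs x K.
Proof. by have [a ax] := mfd_cover M x; exact: chart_compact_nbhs ax. Qed.

Lemma smooth_fun_continuous (M : smooth_manifold R X n) (f : X -> R) :
  smooth_fun M f -> continuous f.
Proof.
move=> sf x; have [a ax] := mfd_cover M x.
have ex : nbhs x (chart_dom (mfd_chart a)).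
  by apply: open_nbhs_nbhs; split=> //; exact: chart_dom_open.
have E : {near x, in_chart a f \o chart_map (mfd_chart a) =1 f}.
  by apply: filterS ex => z az; rewrite /in_chart /= chart_mapK.
have cf : {for x, continuous (in_chart a f \o chart_map (mfd_chart a))}.
  apply: continuous_comp; first exact: chart_map_continuous.
  apply: differentiable_continuous.
  by apply: smooth_on_differentiable (sf a) _; exact: chart_map_cod.
have fx : in_chart a f (chart_map (mfd_chart a) x) = f x := nbhs_singleton E.
rewrite /continuous_at -fx; apply: cvg_trans cf.
exact: near_eq_cvg.
Qed.

End manifold_topology.

(** * Calibrated planes *)

Section exterior_algebra.
Context (R : realType).

Lemma set_row_id p n (i : 'I_p) (V : 'M[R]_(p, n)) : set_row i (row i V) V = V.
Proof. by apply/matrixP => j k; rewrite !mxE; case: eqP => [->|_]; rewrite mxE. Qed.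

Lemma row_set_row p n (i j : 'I_p) (u : 'rV[R]_n) (V : 'M[R]_(p, n)) :
  row j (set_row i u V) = if j == i then u else row j V.
Proof. by apply/rowP => k; rewrite !mxE; case: eqP => // _; rewrite mxE. Qed.

Lemma multilinear_row0 p n (w : 'M[R]_(p, n) -> R) i V :
  multilinear_rows w -> w (set_row i 0 V) = 0.
Proof.
move=> mw; have := mw i 1 0 0 V; rewrite scaler0 addr0 mul1r => h; lra.
Qed.

Lemma multilinear_rowZ p n (w : 'M[R]_(p, n) -> R) i c u V :
  multilinear_rows w -> w (set_row i (c *: u) V) = c * w (set_row i u V).
Proof. by move=> mw; have := mw i c u 0 V; rewrite multilinear_row0// !addr0. Qed.

Lemma multilinear_rowD p n (w : 'M[R]_(p, n) -> R) i u v V :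
  multilinear_rows w ->
  w (set_row i (u + v) V) = w (set_row i u V) + w (set_row i v V).
Proof. by move=> mw; have := mw i 1 u v V; rewrite scale1r mul1r. Qed.

Lemma multilinear_row_sum p n (w : 'M[R]_(p, n) -> R) i V
    (c : 'I_p -> R) (u : 'I_p -> 'rV[R]_n) :
  multilinear_rows w ->
  w (set_row i (\sum_j c j *: u j) V) = \sum_j c j * w (set_row i (u j) V).
Proof.
move=> mw; elim/big_rec2: _ => [|j x s _ <-]; first exact: multilinear_row0.
exact: mw.
Qed.

(** Expand along row [i]: the two matrices differ only at (i, i), which does
    not enter the cofactors of that row. *)
Lemma det_add_delta p (A : 'M[R]_p) (c : R) (i : 'I_p) :
  \det (A + c *: delta_mx i i) = \det A + c * cofactor A i i.
Proof.
rewrite (expand_det_row _ i) (expand_det_row A i).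
have cof j : cofactor (A + c *: delta_mx i i) i j = cofactor A i j.
  rewrite /cofactor; congr (_ * \det _); apply/matrixP => k l.
  by rewrite !mxE eq_sym (negbTE (neq_lift _ _)) mulr0 addr0.
under eq_bigr do rewrite cof !mxE mulrDl.
rewrite big_split /=; congr (_ + _); rewrite (bigD1 i)//= !eqxx mulr1 big1 ?addr0//.
by move=> j /negbTE ji; rewrite ji andbF mulr0 mul0r.
Qed.

Section calibrated_plane.
Context (p n : nat) (G : 'M[R]_n) (w : 'M[R]_(p, n) -> R) (V : 'M[R]_(p, n)).
Hypotheses (G_sym : G^T = G)
  (G_pos : forall v : 'rV[R]_n, 0 <= (v *m G *m v^T) 0 0)
  (w_mul : multilinear_rows w) (w_alt : alternating_rows w)
  (w_le1 : forall W : 'M[R]_(p, n), \det (W *m G *m W^T) = 1 -> w W <= 1)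
  (V_unit : \det (V *m G *m V^T) = 1) (wV : w V = 1).

(** As [u] is orthogonal to the rows of [V], the new Gram matrix is the old one
    with row and column [i] scaled by [b], plus [a ^+ 2 * <u, u>] at (i, i). *)
Lemma det_gram_set_row i (u : 'rV[R]_n) (a b : R) : V *m G *m u^T = 0 ->
  let W := set_row i (a *: u + b *: row i V) V in
  \det (W *m G *m W^T) =
  b ^+ 2 + a ^+ 2 * ((u *m G *m u^T) 0 0 * cofactor (V *m G *m V^T) i i).
Proof.
move=> Vu W.
pose d : 'rV[R]_p := \row_j if j == i then b else 1.
pose E : 'cV[R]_p := delta_mx i 0.
have WE : W = diag_mx d *m V + a *: (E *m u).
  apply/matrixP => j k; rewrite mul_diag_mx !mxE big_ord1 !mxE eqxx andbT.
  by case: eqP => [->|_]; rewrite !mxE ?mul1r ?mul0r ?mulr0 ?addr0// addrC.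
have uV : u *m G *m V^T = 0.
  by rewrite -[u in LHS]trmxK -[G]G_sym -mulmxA -!trmx_mul Vu trmx0.
have -> : W *m G *m W^T = diag_mx d *m (V *m G *m V^T) *m diag_mx d
    + (a ^+ 2 * (u *m G *m u^T) 0 0) *: delta_mx i i.
  rewrite WE linearD /= !linearZ /= !trmx_mul tr_diag_mx !mulmxDl !mulmxDr.
  rewrite -!scalemxAl -!scalemxAr.
  have -> : diag_mx d *m V *m G *m (u^T *m E^T) = 0.
    by rewrite mulmxA -(mulmxA _ V G) -(mulmxA _ (V *m G)) Vu mulmx0 mul0mx.
  have -> : E *m u *m G *m (V^T *m diag_mx d) = 0.
    by rewrite mulmxA -(mulmxA E u G) -(mulmxA E) uV mulmx0 mul0mx.
  rewrite !scaler0 addr0 add0r !mulmxA; congr (_ + _).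
  rewrite scalerA -expr2 -[RHS]scalerA; congr (_ *: _).
  rewrite -(mulmxA E u) -(mulmxA E) {1}[u *m G *m u^T]mx11_scalar.
  by rewrite mul_mx_scalar -scalemxAl /E trmx_delta mul_delta_mx.
have det_d : \det (diag_mx d) = b.
  rewrite det_diag (bigD1 i)//= mxE eqxx big1 ?mulr1// => j /negbTE ji.
  by rewrite mxE ji.
rewrite det_add_delta !det_mulmx det_d V_unit mulr1 -expr2 -mulrA.
congr (_ + _ * (_ * _)).
rewrite /cofactor; congr (_ * \det _); apply/matrixP => k l.
rewrite mul_diag_mx mul_mx_diag.
by rewrite !mxE ![lift _ _ == _]eq_sym !(negbTE (neq_lift _ _)) mul1r mulr1.
Qed.

(** First cousin principle.  Turning the [i]-th vector of [V] towards [u] by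
    a u + b v_i, where b ^ 2 + a ^ 2 k = 1 for the constant k of
    [det_gram_set_row], yields unit simple vectors on which [w] takes the value
    a S + b, with S its value at a = 1, b = 0.  This never exceeds 1, which is
    attained at a = 0, b = 1; moving along the conic from there yields S = 0. *)
Lemma first_cousin i (u : 'rV[R]_n) : V *m G *m u^T = 0 -> w (set_row i u V) = 0.
Proof.
move=> Vu; set S := w _.
pose k := (u *m G *m u^T) 0 0 * cofactor (V *m G *m V^T) i i.
apply/eqP/negPn/negP => S0.
(* The conic b ^ 2 + a ^ 2 k = 1 is parametrized rationally by t, through
   a = 2 t / (1 + k t ^ 2) and b = (1 - k t ^ 2) / (1 + k t ^ 2); then
   a S + b <= 1 says t S <= k t ^ 2, which fails for small t of the sign of S. *)
have S2 : 0 < S ^+ 2 by rewrite exprn_even_gt0.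
pose c := 1 + `|k| + S ^+ 2.
have k0 := normr_ge0 k.
have c0 : 0 < c by rewrite /c; lra.
pose t := S / c.
have kt : `|k| * t ^+ 2 < 1.
  rewrite /t expr_div_n mulrA ltr_pdivrMr ?exprn_gt0// mul1r /c.
  nra.
have kn := ler_norm k; have kn' := ler_norm (- k); rewrite normrN in kn'.
have t2 := sqr_ge0 t.
have den0 : 0 < 1 + k * t ^+ 2 by nra.
pose a := 2 * t / (1 + k * t ^+ 2).
pose b := (1 - k * t ^+ 2) / (1 + k * t ^+ 2).
have := w_le1 (W := set_row i (a *: u + b *: row i V) V).
rewrite det_gram_set_row// -/k w_mul multilinear_rowZ// set_row_id wV mulr1 -/S.
have -> : b ^+ 2 + a ^+ 2 * k = 1.
  by rewrite /a /b; field; rewrite gt_eqF.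
move=> /(_ erefl); rewrite /a /b.
rewrite mulrAC -mulrDl ler_pdivrMr// mul1r => h.
have : t * S <= k * t ^+ 2 by lra.
rewrite /t expr_div_n mulrAC -expr2 ler_pdivrMr// mulrA.
have -> : k * S ^+ 2 / c ^+ 2 * c = k * S ^+ 2 / c.
  by field; rewrite gt_eqF.
rewrite ler_pdivlMr// => h2.
have : c <= k by rewrite -(ler_pM2l S2) [leRHS]mulrC.
rewrite /c; lra.
Qed.

(** The sum is the squared length of the orthogonal projection of [u] onto the
    span of the rows of [V]: the normal part of [u] is killed by
    [first_cousin], and the component of [u] along row [j] of [V] contributes to
    [w (set_row i u V)] only if j = i, because [w] is alternating. *)
Lemma calibrated_rank_one_ge0 (u : 'rV[R]_n) :
  0 <= \sum_(i < p) (row i V *m G *m u^T) 0 0 * w (set_row i u V).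
Proof.
(* c holds the coordinates, in the rows of V, of the tangential part of u;
   u' is the normal part. *)
pose Gm := V *m G *m V^T.
have Gmu : Gm \in unitmx by rewrite unitmxE /Gm V_unit unitr1.
pose c : 'rV[R]_p := u *m G *m V^T *m invmx Gm.
pose u' := u - c *m V.
have cGm : c *m Gm = u *m G *m V^T by rewrite /c mulmxKV.
have u'V : V *m G *m u'^T = 0.
  rewrite -[V]trmxK -[G]G_sym -mulmxA -!trmx_mul.
  by rewrite /u' !mulmxBl -!(mulmxA c) -/Gm cGm subrr trmx0.
have wE i : w (set_row i u V) = c 0 i.
  have uE : u = \sum_j c 0 j *: row j V + u'.
    by rewrite -mulmx_sum_row /u' addrC subrK.
  rewrite {1}uE multilinear_rowD// (first_cousin i u'V) addr0 multilinear_row_sum//.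
  rewrite (bigD1 i)//= set_row_id wV mulr1 big1 ?addr0// => j ji.
  by rewrite (w_alt ji) ?mulr0// !row_set_row eqxx (negbTE ji).
have -> : \sum_(i < p) (row i V *m G *m u^T) 0 0 * w (set_row i u V)
    = ((c *m V) *m G *m (c *m V)^T) 0 0.
  have -> : (c *m V) *m G *m (c *m V)^T = (c *m Gm) *m c^T.
    by rewrite /Gm trmx_mul !mulmxA.
  rewrite cGm mxE.
  apply: eq_bigr => i _; rewrite wE [c^T i 0]mxE; congr (_ * _).
  have -> : (u *m G *m V^T) 0 i = (u *m G *m (row i V)^T) 0 0.
    rewrite [LHS]mxE [RHS]mxE; apply: eq_bigr => k _.
    by rewrite [V^T _ _]mxE [(row i V)^T _ _]mxE [row i V _ _]mxE.
  have -> : row i V *m G *m u^T = (u *m G *m (row i V)^T)^T.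
    by rewrite !trmx_mul trmxK G_sym mulmxA.
  by rewrite mxE.
exact: G_pos.
Qed.

End calibrated_plane.
End exterior_algebra.

(** * The calibrated Hessian *)

Section matrix_derivatives.
Context (R : realType) (V : normedModType R).

Lemma derivable_bigsum I (r : seq I) (P : pred I) (h : I -> V -> R) y v :
  (forall i, derivable (h i) y v) ->
  derivable (fun z => \sum_(i <- r | P i) h i z) y v.
Proof.
move=> dh; elim: r => [|i r IH].
  under eq_fun do rewrite big_nil; exact: derivable_cst.
under eq_fun do rewrite big_cons.
by case: (P i) => //; exact: derivableD.
Qed.

Lemma derivable_bigprod I (r : seq I) (P : pred I) (h : I -> V -> R) y v :
  (forall i, derivable (h i) y v) ->
  derivable (fun z => \prod_(i <- r | P i) h i z) y v.
Proof.
move=> dh; elim: r => [|i r IH].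
  under eq_fun do rewrite big_nil; exact: derivable_cst.
under eq_fun do rewrite big_cons.
by case: (P i) => //; exact: derivableM.
Qed.

Lemma derivable_det n (A : V -> 'M[R]_n) y v :
  (forall i j, derivable (fun z => A z i j) y v) ->
  derivable (fun z => \det (A z)) y v.
Proof.
move=> dA; apply: derivable_bigsum => s; apply: derivableM.
  exact: derivable_cst.
exact: derivable_bigprod.
Qed.

(** Cramer's rule makes the entries of the inverse rational functions of those
    of the matrix. *)
Lemma derivable_invmx n (A : V -> 'M[R]_n) y v :
  (\forall z \near y, A z \in unitmx) -> derivable A y v ->
  derivable (fun z => invmx (A z)) y v.
Proof.
move=> uA /derivable_mxP dA; apply/derivable_mxP => i j.
apply: (@near_eq_derivable _ _ _ (fun z => (\det (A z))^-1 * cofactor (A z) j i)).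
  by near=> z; rewrite /invmx (near uA z)//= !mxE.
apply: derivableM.
  apply: derivableV; last exact: derivable_det.
  by have := nbhs_singleton uA; rewrite /= unitmxE unitfE.
apply: derivableM; first exact: derivable_cst.
apply: derivable_det => k l.
rewrite (_ : (fun _ => _) = (fun z => A z (lift j k) (lift i l))) //.
by apply/funext => z; rewrite !mxE.
Unshelve. all: by end_near. Qed.

Lemma derivable_mulmx m n q (A : V -> 'M[R]_(m, n)) (B : V -> 'M[R]_(n, q)) y v :
  derivable A y v -> derivable B y v -> derivable (fun z => A z *m B z) y v.
Proof.
move=> /derivable_mxP dA /derivable_mxP dB; apply/derivable_mxP => i j.
under eq_fun do rewrite mxE.
apply: derivable_bigsum => k; exact: derivableM.
Qed.

Lemma deriveZ_mx m n (s : V -> R) (W : V -> 'M[R]_(m, n)) y v :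
  derivable s y v -> derivable W y v ->
  derivable (fun z => s z *: W z) y v /\
  'D_v (fun z => s z *: W z) y = s y *: 'D_v W y + 'D_v s y *: W y.
Proof.
move=> ds dW; have dWij := (derivable_mxP _ _ _).1 dW.
have dsW : derivable (fun z => s z *: W z) y v.
  apply/derivable_mxP => i j; under eq_fun do rewrite mxE.
  exact: derivableM.
split=> //; rewrite !derive_mx//; apply/matrixP => i j; rewrite !mxE.
under eq_fun do rewrite mxE.
rewrite (deriveM (f := s) (g := fun z => W z i j))// /GRing.scale /=.
by rewrite [W y i j * _]mulrC.
Qed.

End matrix_derivatives.

Section hessian.
Context (R : realType) (X : topologicalType) (n p : nat).
Context (M : smooth_manifold R X n) (g : riemannian_metric M)
  (phi : diff_form M p).
Implicit Types (f h : X -> R) (a : mfd_idx M) (y v : 'rV[R]_n) (V : 'M[R]_(p, n)).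

Lemma near_cod a y : mfd_cod a y -> \forall z \near y, mfd_cod a z.
Proof. by apply: near_open; exact: chart_cod_open. Qed.

Lemma smooth_fun_differentiable f a y : smooth_fun M f -> mfd_cod a y ->
  differentiable (in_chart a f) y.
Proof. by move=> sf; apply: smooth_on_differentiable; exact: sf. Qed.

Lemma smooth_fun_derivable f a y v : smooth_fun M f -> mfd_cod a y ->
  derivable (in_chart a f) y v.
Proof. by move=> sf ay; apply/diff_derivable/smooth_fun_differentiable. Qed.

Lemma derivable_gradient f a y v : smooth_fun M f -> mfd_cod a y ->
  derivable (gradient g a f) y v.
Proof.
move=> sf ay; apply: derivable_mulmx.
  apply/derivable_mxP => i j; under eq_fun do rewrite mxE.
  apply: diff_derivable; apply: (smooth_on_differentiable _ ay).
  by apply: smooth_on_derive; exact: sf.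
apply: derivable_invmx.
  by apply: filterS (near_cod ay) => z; exact: metric_unit.
by apply: diff_derivable; exact: (metric_smooth g [::] ay).
Qed.

Lemma derive_gradient f a y v : smooth_fun M f -> mfd_cod a y ->
  'D_v (in_chart a f) y = (v *m g a y *m (gradient g a f y)^T) 0 0.
Proof.
move=> sf ay; have df := smooth_fun_differentiable sf ay.
rewrite -(Defs.metric_sym g ay) -mulmxA -trmx_mul /gradient mulmxKV ?metric_unit//.
rewrite [v in LHS]row_sum_delta deriveE// linear_sum mxE.
apply: eq_bigr => j _; by rewrite linearZ /= !mxE deriveE.
Qed.

Lemma covariant_derivD a y v (W1 W2 : 'rV[R]_n -> 'rV[R]_n) :
  derivable W1 y v -> derivable W2 y v ->
  covariant_deriv g a y v (W1 + W2) =
  covariant_deriv g a y v W1 + covariant_deriv g a y v W2.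
Proof.
move=> d1 d2; rewrite /covariant_deriv deriveD// addrACA; congr (_ + _).
apply/rowP => k; rewrite !mxE -big_split; apply: eq_bigr => i _.
rewrite -big_split; apply: eq_bigr => j _; rewrite mxE mulrDr //.
Qed.

Lemma covariant_derivZ a y v (s : 'rV[R]_n -> R) (W : 'rV[R]_n -> 'rV[R]_n) :
  derivable s y v -> derivable W y v ->
  covariant_deriv g a y v (fun z => s z *: W z) =
  s y *: covariant_deriv g a y v W + 'D_v s y *: W y.
Proof.
move=> ds dW; have [_ dsW] := deriveZ_mx ds dW.
rewrite /covariant_deriv dsW scalerDr -!addrA; congr (_ + _).
rewrite addrC; congr (_ + _).
apply/rowP => k; rewrite !mxE mulr_sumr; apply: eq_bigr => i _.
rewrite mulr_sumr; apply: eq_bigr => j _; rewrite mxE mulrCA //.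
Qed.

Lemma near_eq_covariant_deriv a y v (W1 W2 : 'rV[R]_n -> 'rV[R]_n) :
  (\forall z \near y, W1 z = W2 z) ->
  covariant_deriv g a y v W1 = covariant_deriv g a y v W2.
Proof.
move=> W12; rewrite /covariant_deriv (near_eq_derive _ W12).
by rewrite (nbhs_singleton W12).
Qed.

Lemma near_eq_gradient f h a y :
  (\forall z \near y, in_chart a f z = in_chart a h z) ->
  gradient g a f y = gradient g a h y.
Proof.
move=> fh; rewrite /gradient; congr (_ *m _); apply/rowP => j.
by rewrite !mxE (near_eq_derive _ fh).
Qed.

Lemma near_eq_phi_hessian f h a y V :
  (\forall z \near y, in_chart a f z = in_chart a h z) ->
  phi_hessian g phi f a y V = phi_hessian g phi h a y V.
Proof.
move=> fh; apply: eq_bigr => i _; congr (phi _ _ (set_row _ _ _)).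
apply: near_eq_covariant_deriv.
by move/near_join: fh; apply: filterS => z; exact: near_eq_gradient.
Qed.

Lemma gradientD f h a y : smooth_fun M f -> smooth_fun M h -> mfd_cod a y ->
  gradient g a (f + h) y = gradient g a f y + gradient g a h y.
Proof.
move=> sf sh ay; rewrite /gradient -mulmxDl; congr (_ *m _).
apply/rowP => j; rewrite !mxE.
by rewrite (deriveD (f := in_chart a f) (g := in_chart a h))//;
  exact: smooth_fun_derivable.
Qed.

Lemma phi_hessianD f h a y V : smooth_fun M f -> smooth_fun M h -> mfd_cod a y ->
  phi_hessian g phi (f + h) a y V =
  phi_hessian g phi f a y V + phi_hessian g phi h a y V.
Proof.
move=> sf sh ay; rewrite /phi_hessian -big_split; apply: eq_bigr => i _.
have Z : \forall z \near y,
    gradient g a (f + h) z = (gradient g a f + gradient g a h) z.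
  by apply: filterS (near_cod ay) => z az; exact: gradientD.
rewrite (near_eq_covariant_deriv _ _ Z) covariant_derivD;
  try exact: derivable_gradient.
exact/multilinear_rowD/form_multilinear.
Qed.

Lemma gradient_comp (chi chi' : R -> R) f a y :
  (forall t : R, is_derive t (1 : R) chi (chi' t)) ->
  smooth_fun M f -> mfd_cod a y ->
  gradient g a (chi \o f) y = chi' (in_chart a f y) *: gradient g a f y.
Proof.
move=> dchi sf ay; rewrite /gradient scalemxAl; congr (_ *m _).
apply/rowP => j; rewrite !mxE.
have [_ ] := derive_comp (basis_vec j) (smooth_fun_differentiable sf ay)
  (dchi (in_chart a f y)).
exact.
Qed.

(** As grad (chi o f) = chi'(f) grad f, the derivative along v_i is
    chi'(f) nabla_(v_i) grad f + chi''(f) df(v_i) grad f, where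
    df(v_i) = <v_i, grad f>. *)
Lemma phi_hessian_comp (chi : nat -> R -> R) f a y V :
  (forall j (t : R), is_derive t (1 : R) (chi j) (chi j.+1 t)) ->
  smooth_fun M f -> mfd_cod a y ->
  phi_hessian g phi (chi 0 \o f) a y V =
  chi 1 (in_chart a f y) * phi_hessian g phi f a y V +
  chi 2 (in_chart a f y) * \sum_(i < p)
    (row i V *m g a y *m (gradient g a f y)^T) 0 0 *
    phi a y (set_row i (gradient g a f y) V).
Proof.
move=> dchi sf ay; rewrite /phi_hessian !mulr_sumr -big_split.
apply: eq_bigr => i _.
have Z : \forall z \near y, gradient g a (chi 0 \o f) z =
    chi 1 (in_chart a f z) *: gradient g a f z.
  by apply: filterS (near_cod ay) => z az; exact: gradient_comp.
have [ds Ds] := derive_comp (row i V) (smooth_fun_differentiable sf ay)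
  (dchi 1 (in_chart a f y)).
rewrite (near_eq_covariant_deriv _ _ Z).
rewrite (covariant_derivZ _ (s := chi 1 \o in_chart a f)); last first.
- exact: derivable_gradient.
- exact: diff_derivable.
have mphi := form_multilinear phi ay.
by rewrite mphi multilinear_rowZ// Ds derive_gradient// mulrA.
Qed.

Hypothesis phi_cal : calibration g phi.

(** In [phi_hessian_comp] the second term is nonnegative on a phi-plane by
    [calibrated_rank_one_ge0]. *)
Lemma psh_comp (chi : nat -> R -> R) f :
  (forall j (t : R), is_derive t (1 : R) (chi j) (chi j.+1 t)) ->
  (forall t, 0 <= chi 1 t) -> (forall t, 0 <= chi 2 t) ->
  psh g phi f -> psh g phi (chi 0 \o f).
Proof.
move=> dchi chi1 chi2 [sf Hf]; split=> [a|a y V ay plV].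
  have Uo : open (mfd_cod a) by exact: chart_cod_open.
  exact: (smooth_on_comp Uo 0 dchi (sf a)).
rewrite phi_hessian_comp// addr_ge0// mulr_ge0//; first exact: Hf.
have [V1 phiV] := plV.
apply: calibrated_rank_one_ge0 => //.
- exact: Defs.metric_sym.
- move=> v; have [->|v0] := eqVneq v 0; first by rewrite !mul0mx mxE.
  exact/ltW/metric_pos.
- exact: form_multilinear.
- exact: form_alternating.
- by move=> W; exact: phi_cal.2.
Qed.

Lemma pshD f h : psh g phi f -> psh g phi h -> psh g phi (f + h).
Proof.
move=> [sf Hf] [sh Hh]; split=> [a|a y V ay plV].
  have Uo : open (mfd_cod a) by exact: chart_cod_open.
  exact: (smooth_onD Uo (sf a) (sh a)).
by rewrite phi_hessianD// addr_ge0//; [exact: Hf|exact: Hh].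
Qed.

(** Smoothness and the Hessian at a point depend only on the germ; this is what
    makes locally finite sums plurisubharmonic. *)
Lemma psh_local f :
  (forall x : X, exists2 h, psh g phi h & \forall z \near x, f z = h z) ->
  psh g phi f.
Proof.
move=> lf.
have near_chart a y : mfd_cod a y -> exists2 h, psh g phi h &
    \forall z \near y, in_chart a h z = in_chart a f z.
  move=> ay; have [h ph fh] := lf (chart_inv (mfd_chart a) y); exists h => //.
  have ci : {for y, continuous (chart_inv (mfd_chart a))}.
    exact: chart_inv_continuous.
  have : \forall z \near y,
    f (chart_inv (mfd_chart a) z) = h (chart_inv (mfd_chart a) z) := ci _ fh.
  by apply: filterS => z fz; rewrite /in_chart /= fz.
split=> [a vs y ay|a y V ay plV].
  have [h [sh _] hf] := near_chart a y ay.
  apply: near_eq_differentiable (sh a vs y ay).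
  elim: vs => [|v vs IH] //=.
  by move/near_join: IH; apply: filterS => z; exact: near_eq_derive.
have [h [_ Hh] hf] := near_chart a y ay.
by rewrite -(near_eq_phi_hessian V hf); exact: Hh.
Qed.

Lemma psh0 : psh g phi (cst 0).
Proof.
split=> [a|a y V ay plV]; first by apply: smooth_on_cst; exact: chart_cod_open.
rewrite /phi_hessian big1// => i _.
have -> : gradient g a (cst 0) = cst 0.
  apply/funext => z; rewrite /gradient (_ : \row_j _ = 0) ?mul0mx//.
  by apply/rowP => j; rewrite !mxE derive_cst.
rewrite (_ : covariant_deriv _ _ _ _ _ = 0).
  exact/multilinear_row0/form_multilinear.
rewrite /covariant_deriv derive_cst add0r; apply/rowP => k; rewrite !mxE.
rewrite big1// => l _; rewrite big1// => j _.
by rewrite /cst [X in _ * X]mxE mulr0.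
Qed.

End hessian.

(** * Convexity and exhaustion *)

Section exhaustion_function.
Context (R : realType) (X : topologicalType) (n p : nat).
Context (M : smooth_manifold R X n) (g : riemannian_metric M)
  (phi : diff_form M p).
Hypothesis phi_cal : calibration g phi.
Implicit Types (f : X -> R) (K D : set X).

Lemma compact_bounded_above f K : continuous f -> compact K ->
  exists c, forall x, K x -> f x <= c.
Proof.
move=> cf cK.
apply: (compact_induction
  (P := fun A : set X => exists c, forall x, A x -> f x <= c) cK).
- by exists 0.
- move=> A B [c Ac] [d Bd]; exists (Num.max c d) => x.
  by move=> [/Ac|/Bd] h; rewrite le_max h ?orbT.
- by move=> A B AB [c Bc]; exists c => x /AB /Bc.
move=> x _; exists [set y | f y < f x + 1]; last by exists (f x + 1) => y /ltW.
apply: (cf x [set t | t < f x + 1]); apply: lt_nbhsl; lra.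
Qed.

Lemma relatively_compact_sub D K : hausdorff_space X -> compact K -> D `<=` K ->
  relatively_compact D.
Proof.
move=> hX cK DK; apply: (subclosed_compact _ cK); first exact: closed_closure.
have /closure_id -> := compact_closed hX cK; exact: closureS.
Qed.

(** Some plurisubharmonic [f] satisfies [f <= c] on [K] and [c < f x]; then
    b chi(f - c) has the required properties for [b] large. *)
Lemma separating_psh K x (A : R) : ~ convex_hull g phi K x ->
  exists k : X -> R, [/\ psh g phi k, forall z, 0 <= k z,
    forall z, K z -> k z = 0 & A < k x].
Proof.
move=> /existsNP[f /not_implyP[pf /negP]]; rewrite -ltNge => fx.
have [c Kc cx] : exists2 c : R, (forall z, K z -> f z <= c) & c < f x.
  move: fx; case E : (ereal_sup _) => [s||] fx //.
  - exists s => [z Kz|]; last by rewrite -lte_fin.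
    by rewrite -lee_fin -E; apply: ereal_sup_ubound; exists z.
  (* This happens when K is empty. *)
  - exists (f x - 1) => [z Kz|]; last lra.
    have : ((f z)%:E <= -oo)%E by rewrite -E; apply: ereal_sup_ubound; exists z.
    by [].
have chi_pos : 0 < chi 0 (f x - c) by apply: chi_gt0; rewrite subr_gt0.
pose b := (`|A| + 1) / chi 0 (f x - c).
have b0 : 0 < b by rewrite divr_gt0// ltr_wpDl.
pose psi j (t : R) := b * chi j (t - c).
have dpsi j (t : R) : is_derive t (1 : R) (psi j) (psi j.+1 t).
  have ds : is_derive t (1 : R) (fun t : R => t - c) 1.
    have := is_deriveB (is_derive_id t 1) (is_derive_cst c t 1).
    by move=> h; apply: is_derive_eq h _; rewrite subr0.
  have dc := @is_derive1_comp R (chi j) (fun t => t - c) t _ _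
    (is_derive_chi j (t - c)) ds.
  by apply: is_derive_eq (is_deriveZ b dc) _; rewrite mulr1.
exists (psi 0 \o f); split.
- apply: psh_comp => //.
  + by move=> t; rewrite mulr_ge0 ?chi1_ge0// ltW.
  + by move=> t; rewrite mulr_ge0 ?chi2_ge0// ltW.
- move=> z; rewrite /psi /= mulr_ge0 ?(ltW b0)//.
  by have [h|/chi_gt0/ltW//] := leP (f z - c) 0; rewrite chi_le0.
- by move=> z /Kc fz; rewrite /psi /= chi_le0 ?mulr0// subr_le0.
- rewrite /psi /= /b divfK ?gt_eqF//; have := ler_norm A; lra.
Qed.

(** The functions of [separating_psh] do the work near each point of [D]; since
    they are nonnegative, adding two of them keeps the bounds of both. *)
Lemma separating_psh_compact K D (A : R) : compact D ->
  (forall x, D x -> ~ convex_hull g phi K x) ->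
  exists k : X -> R, [/\ psh g phi k, forall z, 0 <= k z,
    forall z, K z -> k z = 0 & forall x, D x -> A < k x].
Proof.
move=> cD DK.
apply: (compact_induction (P := fun B : set X =>
  exists k : X -> R, [/\ psh g phi k, forall z, 0 <= k z,
    forall z, K z -> k z = 0 & forall x, B x -> A < k x]) cD).
- by exists (cst 0); split => //; exact: psh0.
- move=> B1 B2 [k1 [pk1 k1_ge0 k1K k1B]] [k2 [pk2 k2_ge0 k2K k2B]].
  exists (k1 + k2); split.
  + exact: pshD.
  + by move=> z; rewrite addr_ge0.
  + by move=> z Kz; rewrite !fctE k1K// k2K// addr0.
  + move=> z; rewrite !fctE.
    by move=> [/k1B|/k2B]; [have := k2_ge0 z|have := k1_ge0 z]; lra.
- by move=> B1 B2 B12 [k [pk k0 kK kB]]; exists k; split => // x /B12 /kB.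
- move=> x /DK /(separating_psh A)[k [pk k0 kK kx]].
  exists [set z | A < k z]; last by exists k.
  have ck : continuous k by exact: smooth_fun_continuous pk.1.
  by apply: (ck x [set t | A < t]); exact: lt_nbhsr.
Qed.

Lemma psh_sum N (k : nat -> X -> R) : (forall m, psh g phi (k m)) ->
  psh g phi (fun z => \sum_(m < N) k m z).
Proof.
move=> pk; elim: N => [|N IH].
  by under eq_fun do rewrite big_ord0; exact: psh0.
by under eq_fun do rewrite big_ord_recr /=; exact: pshD.
Qed.

Section locally_finite_sum.
Variables (C : nat -> set X) (k : nat -> X -> R).
Hypotheses (CS : forall m, C m `<=` (C m.+1)°)
  (Ccover : forall x, exists m, C m x)
  (k_psh : forall m, psh g phi (k m)) (k_ge0 : forall m z, 0 <= k m z)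
  (kC : forall m z, C m z -> k m z = 0).

Let Cle m m' : (m <= m')%N -> C m `<=` C m'.
Proof.
elim: m' => [|m' IH]; first by rewrite leqn0 => /eqP ->.
rewrite leq_eqVlt => /predU1P[->//|]; rewrite ltnS => /IH mm' x /mm'.
by move/CS; exact: interior_subset.
Qed.

Let sum_tail x N N' : C N x -> (N <= N')%N ->
  \sum_(m < N') k m x = \sum_(m < N) k m x.
Proof.
move=> CN NN'; rewrite -!(big_mkord xpredT (fun m => k m x)).
rewrite (big_cat_nat (leq0n N) NN')//=.
rewrite [X in _ + X]big_nat [X in _ + X]big1 ?addr0// => m /andP[Nm _].
by apply: kC; exact: Cle CN.
Qed.

(** Near a point of [C m] only the terms of index at most [m] are nonzero. *)
Lemma locally_finite_psh_sum : exists2 F : X -> R, psh g phi F &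
  forall m x, C m x -> F x = \sum_(j < m) k j x.
Proof.
have /choice[N CN] := Ccover.
have FE m x : C m x -> \sum_(j < N x) k j x = \sum_(j < m) k j x.
  move=> Cm; have [h|/ltnW h] := leqP (N x) m.
    by rewrite (sum_tail (CN x) h).
  by rewrite (sum_tail Cm h).
exists (fun x => \sum_(j < N x) k j x) => //.
apply: psh_local => x; exists (fun z => \sum_(j < (N x).+1) k j z).
  exact: psh_sum.
by have := CS (CN x); apply: filterS => z; exact: FE.
Qed.

(** If [x] is outside [C m.+1], let [C j.+2] be the first set of the exhaustion
    that contains it: then m <= j, and the term [k j] alone already exceeds
    [j]. *)
Lemma proper_locally_finite_sum F : C 0 = set0 ->
  (forall m, compact (C m)) ->
  (forall m x, C m.+2 x -> ~ (C m.+1)° x -> m%:R < k m x) ->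
  continuous F -> (forall m x, C m x -> F x = \sum_(j < m) k j x) ->
  proper_exhaustion F.
Proof.
move=> C0 cC k_gt cF FE c.
have [m cm] : exists m : nat, c < m%:R.
  exists (Num.bound `|c|); apply: le_lt_trans (ler_norm c) _.
  exact: archi_boundP.
apply: (subclosed_compact _ (cC m.+1)).
  have /continuous_closedP := cF; move=> /(_ [set t | t <= c]); apply.
  exact: closed_le.
move=> x /= Fc; apply: contrapT => nC.
have [j Cj nCj] : exists2 j, C j.+1 x & ~ C j x.
  have [N] := Ccover x; elim: N => [|N IH]; first by rewrite C0.
  by have [/IH//|nCN CN] := pselect (C N x); exists N.
have mj : (m < j)%N.
  by rewrite ltnNge; apply/negP => jm; apply: nC; apply: Cle Cj.
case: j mj Cj nCj => // j mj Cj nCj.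
have kj : j%:R < k j x by apply: k_gt => // /interior_subset.
have mjR : m%:R <= j%:R :> R by rewrite ler_nat -ltnS.
have : k j x <= F x.
  rewrite (FE _ _ Cj) 2!big_ord_recr /=.
  have := k_ge0 j.+1 x.
  have : 0 <= \sum_(i < j) k i x by apply: sumr_ge0.
  lra.
lra.
Qed.

End locally_finite_sum.
End exhaustion_function.

Unset Implicit Arguments.
Set Strict Implicit.

Theorem theorem3p3 (R : realType) (X : topologicalType) (n p : nat)
    (M : smooth_manifold R X n) (g : riemannian_metric M) (phi : diff_form M p)
    (p_ge1 : (1 <= p)%N)
    (phi_cal : calibration g phi)
    (X_noncompact : ~ compact [set: X])
    (X_connected : connected [set: X]) :
  (forall K : set X, compact K -> relatively_compact (convex_hull g phi K))
  <->
  (exists f : X -> R, psh g phi f /\ proper_exhaustion f).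
Proof.
have hX := mfd_hausdorff M.
split=> [hull_rc|[f [pf ef]] K cK]; last first.
  have [c Kc] := compact_bounded_above (smooth_fun_continuous pf.1) cK.
  apply: (relatively_compact_sub hX (ef c)) => x /(_ f pf) fx.
  rewrite /= -lee_fin; apply: le_trans fx _.
  by apply: ge_ereal_sup => _ [y Ky <-]; rewrite lee_fin; exact: Kc.
have [C [C0 cC CS HC Ccover]] := compact_exhaustion hX
  (mfd_second_countable M) (manifold_compact_nbhs M) hull_rc.
have /choice[k hk] : forall m, exists k : X -> R, [/\ psh g phi k,
    forall z, 0 <= k z, forall z, C m z -> k z = 0 &
    forall x, (C m.+2 `&` ~` (C m.+1)°) x -> m%:R < k x].
  move=> m; apply: separating_psh_compact => //.
    by apply: compact_closedI => //; apply: open_closedC; exact: open_interior.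
  by move=> x [_ nC] /HC.
have k_psh m : psh g phi (k m) by have [] := hk m.
have k_ge0 m z : 0 <= k m z by have [_ + _ _] := hk m; exact.
have kC m z : C m z -> k m z = 0 by have [_ _ + _] := hk m; exact.
have k_gt m x : C m.+2 x -> ~ (C m.+1)° x -> m%:R < k m x.
  by move=> Cx nCx; have [_ _ _] := hk m; apply.
have [F pF FE] := locally_finite_psh_sum CS Ccover k_psh kC.
exists F; split=> //.
apply: (proper_locally_finite_sum CS Ccover k_ge0 C0 cC k_gt _ FE).
exact: smooth_fun_continuous pF.1.
Qed.
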